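(* Let $A$ be a finite-dimensional left-symmetric algebra over a field $\mathbb{F}$ of characteristic zero. If $A$ is a Novikov algebra or a derivation algebra, then $Z(A)=\mathcal{Z}_A$ is a two-sided ideal of $A$.
   Context: A left-symmetric algebra over $\mathbb{F}$ is a vector space $A$ over $\mathbb{F}$ with a bilinear product $\cdot$ such that $(x,y,z)=(y,x,z)$ for all $x,y,z\in A$, where $(x,y,z)=(x\cdot y)\cdot z-x\cdot(y\cdot z)$ is the associator. Its associated Lie algebra $\mathcal{G}_A$ is $A$ with bracket $[x,y]=x\cdot y-y\cdot x$, and $\mathcal{Z}_A$ denotes the center of the Lie algebra $\mathcal{G}_A$. A left-symmetric algebra is a Novikov algebra if $(x\cdot y)\cdot z=(x\cdot z)\cdot y$ for all $x,y,z$, and a derivation algebra if $(x\cdot y)\cdot z=(z\cdot y)\cdot x$ for all $x,y,z$. The center $Z(A)$ is the set of all $z\in A$ such that $x\cdot z=z\cdot x$ for all $x\in A$ and $(z,x,y)=(x,z,y)=(x,y,z)=0$ for all $x,y\in A$. *)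

(* Defs.v *)
From HB Require Import structures.
From mathcomp Require Import all_boot all_order all_algebra sesquilinear.
From mathcomp Require Import boolp classical_sets.

Set Implicit Arguments.
Unset Strict Implicit.
Unset Printing Implicit Defensive.

Import GRing.Theory.
Local Open Scope ring_scope.
Local Open Scope classical_set_scope.

(* A nonassociative algebra is a module A together with a bilinear product mul,
   kept explicit because MathComp's algebra structures are associative and
   unital. *)

Section NonassociativeAlgebra.
Variables (F : fieldType) (A : lmodType F).
Implicit Types (mul : {bilinear A -> A -> A}) (I : set A).

Definition nassociator mul (x y z : A) : A := mul (mul x y) z - mul x (mul y z).

Definition left_symmetric_algebra mul :=
  forall x y z, nassociator mul x y z = nassociator mul y x z.

Definition novikov_algebra mul :=
  left_symmetric_algebra mul /\
  forall x y z, mul (mul x y) z = mul (mul x z) y.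

Definition derivation_algebra mul :=
  left_symmetric_algebra mul /\
  forall x y z, mul (mul x y) z = mul (mul z y) x.

Definition lie_bracket mul (x y : A) : A := mul x y - mul y x.

Definition lie_center (br : A -> A -> A) : set A :=
  [set z | forall x, br z x = 0].

Definition algebra_center mul : set A :=
  [set z | (forall x, mul x z = mul z x) /\
           forall x y, [/\ nassociator mul z x y = 0,
                           nassociator mul x z y = 0 &
                           nassociator mul x y z = 0]].

Definition two_sided_ideal mul I :=
  GRing.submod_closed (mem I) /\
  forall x z, I z -> I (mul x z) /\ I (mul z x).

End NonassociativeAlgebra.

(* Main.v *)
Require Import Defs.
From mathcomp Require Import all_boot all_order all_algebra sesquilinear.
From mathcomp Require Import boolp classical_sets.

(* Let z commute with everything.  Left symmetry gives z(yw) = y(zw).  In both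
   classes (zx)y is symmetric in x and y and equals z(xy); hence all associators
   involving z vanish, and y(zx) = z(yx) = (zy)x = (zx)y, so zx is again in the
   Lie center. *)

Import GRing.Theory.
Local Open Scope ring_scope.

Section LieCenter.
Context {F : fieldType} {A : lmodType F} {mul : {bilinear A -> A -> A}}.

Lemma lie_centerP z :
  lie_center (lie_bracket mul) z <-> forall x, mul z x = mul x z.
Proof.
split=> zC x; first by apply/eqP; rewrite -subr_eq0; apply/eqP/zC.
by rewrite /lie_bracket zC subrr.
Qed.

Lemma lie_center_submod_closed :
  GRing.submod_closed (mem (lie_center (lie_bracket mul))).
Proof.
split=> [|a u v]; rewrite !in_setE !lie_centerP.
  by move=> x; rewrite linear0l linear0r.
by move=> uC vC x; rewrite linearPl linearPr uC vC.
Qed.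

Lemma algebra_center_sub_lie_center z :
  algebra_center mul z -> lie_center (lie_bracket mul) z.
Proof. by case=> zC _; apply/lie_centerP=> x; rewrite zC. Qed.

Hypothesis lsA : left_symmetric_algebra mul.

(** Since zx = xz, the terms (zx)y and (xz)y cancel from left symmetry. *)
Lemma lie_center_mulCA {z} : lie_center (lie_bracket mul) z ->
  forall x y, mul z (mul x y) = mul x (mul z y).
Proof.
move=> /lie_centerP zC x y; apply: oppr_inj.
by have := lsA z x y; rewrite /nassociator zC => /addrI.
Qed.

Hypothesis ndA : novikov_algebra mul \/ derivation_algebra mul.

Lemma lie_center_mulAC {z} : lie_center (lie_bracket mul) z ->
  forall x y, mul (mul z x) y = mul (mul z y) x.
Proof.
move=> /lie_centerP zC x y; case: ndA => -[_ mulE]; first exact: mulE.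
(* Derivation case: the outer factors of (xz)y are swapped, with z in the middle. *)
by rewrite zC mulE -zC.
Qed.

Lemma lie_center_mulA {z} : lie_center (lie_bracket mul) z ->
  forall x y, mul (mul z x) y = mul z (mul x y).
Proof.
move=> zZ x y; have zC := (lie_centerP z).1 zZ; case: ndA => -[_ mulE].
  (* Novikov case: (zx)y = (xz)y = (xy)z = z(xy). *)
  by rewrite zC mulE -zC.
(* Derivation case: swapping the outer factors of (zy)x moves z to the end, giving (xy)z. *)
by rewrite (lie_center_mulAC zZ) mulE -zC.
Qed.

Lemma lie_center_mul {z} : lie_center (lie_bracket mul) z ->
  forall x, lie_center (lie_bracket mul) (mul z x).
Proof.
move=> zZ x; apply/lie_centerP => y.
by rewrite (lie_center_mulAC zZ) (lie_center_mulA zZ) (lie_center_mulCA zZ).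
Qed.

Lemma algebra_center_lie_center :
  algebra_center mul = lie_center (lie_bracket mul).
Proof.
apply/seteqP; split=> z; first exact: algebra_center_sub_lie_center.
move=> zZ; have zC := (lie_centerP z).1 zZ.
have zxy x y : nassociator mul z x y = 0.
  by rewrite /nassociator (lie_center_mulA zZ) subrr.
split=> [x|x y]; first by rewrite zC.
(* Left symmetry turns (x,z,y) into (z,x,y); the last associator (x,y,z) becomes z(xy) - x(zy). *)
split=> //; first by rewrite lsA.
by rewrite /nassociator -!zC (lie_center_mulCA zZ) subrr.
Qed.

End LieCenter.

Theorem proposition16 (F : fieldType) (A : vectType F)
    (mul : {bilinear A -> A -> A})
    (charF0 : [pchar F] =i pred0)
    (lsA : left_symmetric_algebra mul)
    (ndA : novikov_algebra mul \/ derivation_algebra mul) :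
  algebra_center mul = lie_center (lie_bracket mul) /\
  two_sided_ideal mul (algebra_center mul).
Proof.
have ZE := algebra_center_lie_center lsA ndA; split=> //; rewrite ZE.
split=> [|x z zZ]; first exact: lie_center_submod_closed.
(* As xz = zx, both ideal conditions become membership of zx. *)
rewrite -((lie_centerP z).1 zZ).
by split; exact: (lie_center_mul lsA ndA zZ).
Qed.
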